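(* Let $U\subset\mathbb{R}^N$ be open and let $\{\beta_{ij}\}_{i\ne j}$ be smooth real functions on $U$ solving the Darboux-Egoroff equations $$\frac{\partial\beta_{ij}}{\partial u_k}=\beta_{ik}\beta_{kj}\ (i,j,k\text{ pairwise different}),\quad \beta_{ij}=\beta_{ji}\ (i\neq j),\quad \sum_{k=1}^N\frac{\partial\beta_{ij}}{\partial u_k}=0\ (i\ne j).$$ Let $V$ be a finite-dimensional real coordinate space, let $\xi_i:U\to V$ and $\xi_i^*:U\to V^*$, $i=1,\dots,N$, be smooth with $\frac{\partial\xi_j}{\partial u_i}=\beta_{ji}\xi_i$ and $\frac{\partial\xi_j^*}{\partial u_i}=\beta_{ij}\xi_i^*$ for $i\ne j$, and let $\Omega(\xi,\xi^* )$ be a potential, invertible at every point of $U$. Suppose that for some linear operator $L$ on $V$, $$\xi_i^*=\xi_i^{\mathrm t}L=\Big(\frac{\partial\xi_i}{\partial u_i}+\sum_{k\neq i}\xi_k\beta_{ki}\Big)^{\mathrm t},\qquad i=1,\dots,N,$$ $$L^{\mathrm t}\,\Omega(\xi,\xi^* )-\Omega(\xi,\xi^* )^{\mathrm t}L=0,$$ $$\Omega(\xi,\xi^* )+\Omega(\xi,\xi^* )^{\mathrm t}=\sum_{k=1}^N\xi_k\otimes\xi_k^{\mathrm t}.$$ Then the functions $$\hat\beta_{ij}=\beta_{ij}-\langle\xi_j^*,\Omega(\xi,\xi^* )^{-1}\xi_i\rangle,\qquad i\neq j,$$ again solve the Darboux-Egoroff equations: $$\frac{\partial\hat\beta_{ij}}{\partial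 u_k}=\hat\beta_{ik}\hat\beta_{kj}\ (i,j,k\text{ pairwise different}),\quad \hat\beta_{ij}=\hat\beta_{ji}\ (i\neq j),\quad \sum_{k=1}^N\frac{\partial\hat\beta_{ij}}{\partial u_k}=0\ (i\ne j).$$
   Context: Elements of $V=\mathbb{R}^m$ are column vectors, elements of $V^*$ are row vectors, ${}^{\mathrm t}$ denotes transpose and $\langle\cdot,\cdot\rangle$ is the pairing of $V^*$ with $V$. A potential $\Omega(\xi,\xi^* )$ is a smooth function on $U$ with values in the linear maps $V\to V$ such that $\frac{\partial\Omega(\xi,\xi^* )}{\partial u_i}=\xi_i\otimes\xi_i^*$ (the matrix product $\xi_i\xi_i^*$) for $i=1,\dots,N$. It is determined up to an additive constant. *)

(* Defs.v *)
From HB Require Import structures.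
From mathcomp Require Import all_boot all_order all_algebra.
From mathcomp Require Import all_classical all_reals all_analysis.
Set Implicit Arguments.
Unset Strict Implicit.
Unset Printing Implicit Defensive.
Import Order.TTheory GRing.Theory Num.Theory.
Import numFieldNormedType.Exports.
Local Open Scope classical_set_scope.
Local Open Scope ring_scope.

(* Functions on an open set U are total functions on 'rV[R]_N of which only
   the restriction to U matters. As U is open, continuity and differentiability
   at a point of U depend only on this restriction. *)

Definition partial (R : realType) (N : nat) (W : normedModType R) (i : 'I_N)
    (f : 'rV[R]_N -> W) : 'rV[R]_N -> W :=
  fun u => 'D_(delta_mx 0 i) f u.

Fixpoint of_class_C (R : realType) (N : nat) (W : normedModType R) (k : nat)
    (U : set 'rV[R]_N) (f : 'rV[R]_N -> W) : Prop :=
  (forall u, U u -> {for u, continuous f}) /\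
  match k with
  | 0%N => True
  | k'.+1 => forall i : 'I_N,
      (forall u, U u -> derivable f u (delta_mx 0 i)) /\
      of_class_C k' U (partial i f)
  end.

Definition smooth (R : realType) (N : nat) (W : normedModType R)
    (U : set 'rV[R]_N) (f : 'rV[R]_N -> W) : Prop :=
  forall k : nat, of_class_C k U f.

(* The diagonal entries beta i i are unconstrained and play no role. *)
Definition darboux_egoroff (R : realType) (N : nat) (U : set 'rV[R]_N)
    (beta : 'I_N -> 'I_N -> 'rV[R]_N -> R) : Prop :=
  [/\ forall i j, i != j -> smooth U (beta i j),
      forall i j k, i != j -> j != k -> i != k -> forall u, U u ->
        partial k (beta i j) u = beta i k u * beta k j u,
      forall i j, i != j -> forall u, U u -> beta i j u = beta j i u
    & forall i j, i != j -> forall u, U u ->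
        \sum_(k < N) partial k (beta i j) u = 0].

Definition linear_system (R : realType) (N m : nat) (U : set 'rV[R]_N)
    (beta : 'I_N -> 'I_N -> 'rV[R]_N -> R)
    (xi : 'I_N -> 'rV[R]_N -> 'cV[R]_m) : Prop :=
  (forall i, smooth U (xi i)) /\
  (forall i j, i != j -> forall u, U u ->
     partial i (xi j) u = beta j i u *: xi i u).

Definition adjoint_linear_system (R : realType) (N m : nat)
    (U : set 'rV[R]_N) (beta : 'I_N -> 'I_N -> 'rV[R]_N -> R)
    (xis : 'I_N -> 'rV[R]_N -> 'rV[R]_m) : Prop :=
  (forall i, smooth U (xis i)) /\
  (forall i j, i != j -> forall u, U u ->
     partial i (xis j) u = beta i j u *: xis i u).

(* A linear map V -> V is given by the matrix acting on column vectors by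
   left multiplication. *)
Definition potential (R : realType) (N m : nat) (U : set 'rV[R]_N)
    (xi : 'I_N -> 'rV[R]_N -> 'cV[R]_m) (xis : 'I_N -> 'rV[R]_N -> 'rV[R]_m)
    (Omega : 'rV[R]_N -> 'M[R]_m) : Prop :=
  smooth U Omega /\
  (forall i u, U u -> partial i Omega u = xi i u *m xis i u).

Definition pairing (R : realType) (m : nat) (a : 'rV[R]_m) (v : 'cV[R]_m) : R :=
  (a *m v) 0 0.

Definition transformed_beta (R : realType) (N m : nat)
    (beta : 'I_N -> 'I_N -> 'rV[R]_N -> R)
    (xi : 'I_N -> 'rV[R]_N -> 'cV[R]_m) (xis : 'I_N -> 'rV[R]_N -> 'rV[R]_m)
    (Omega : 'rV[R]_N -> 'M[R]_m) (i j : 'I_N) : 'rV[R]_N -> R :=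
  fun u => beta i j u - pairing (xis j u) (invmx (Omega u) *m xi i u).

(* Main.v *)
(** Write W = Omega^-1 and c_ij = xi*_j W xi_i, so that the transformed
    coefficients are beta_ij - c_ij. From dW/du_k = - W xi_k xi*_k W one gets
      dc_ij/du_k = (d_k xi*_j) W xi_i - c_ik c_kj + xi*_j W (d_k xi_i),
    which for pairwise different indices is the first Darboux-Egoroff equation.
    The relation L^T Omega = Omega^T L says that L W is symmetric, hence so is
    c_ij = xi_j^T L W xi_i. By the symmetry of beta, the operator sum_k d_k acts
    as L^T on xi_i, as L (from the right) on xi*_j and sends Omega to
    (Omega + Omega^T) L; since W (Omega + Omega^T) L W = L W + W L^T, the three
    contributions to sum_k d_k c_ij cancel. *)

Require Import Defs.
From HB Require Import structures.
From mathcomp Require Import all_boot all_order all_algebra.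
From mathcomp Require Import all_classical all_reals all_analysis.
From mathcomp Require Import ring.
Import Order.TTheory GRing.Theory Num.Theory.
Import numFieldNormedType.Exports.
Local Open Scope classical_set_scope.
Local Open Scope ring_scope.

(** * Functions of class C^k on an open set: locality and closure properties *)

Section Smoothness.
Context {R : realType} {N : nat}.
Implicit Types (U : set 'rV[R]_N) (k : nat).

(** Openness turns an identity known only on [U] into one valid near each point of [U], so that it
    passes to limits and derivatives there. *)
Lemma near_eq_on_open {T : Type} {U} {f g : 'rV[R]_N -> T} :
  open U -> (forall u, U u -> f u = g u) ->
  forall u, U u -> {near u, f =1 g}.
Proof.
move=> oU fg u Uu; rewrite /prop_near1.
by near=> y; apply: fg; near: y; apply: open_nbhs_nbhs; split.
Unshelve. all: by end_near. Qed.

Lemma eq_partial {W : normedModType R} {U} {f g : 'rV[R]_N -> W} (i : 'I_N) :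
  open U -> (forall u, U u -> f u = g u) ->
  forall u, U u -> partial i f u = partial i g u.
Proof.
by move=> oU fg u Uu; apply: near_eq_derive; apply: near_eq_on_open oU fg u Uu.
Qed.

Lemma eq_continuous_at {W : normedModType R} {U} {f g : 'rV[R]_N -> W} :
  open U -> (forall u, U u -> f u = g u) ->
  forall u, U u -> {for u, continuous f} -> {for u, continuous g}.
Proof.
move=> oU fg u Uu cf; rewrite /prop_for /continuous_at -(fg u Uu).
have fg_near := near_eq_on_open oU fg u Uu.
exact: cvg_trans (near_eq_cvg fg_near) cf.
Qed.

Lemma eq_of_class_C {W : normedModType R} {k U} {f g : 'rV[R]_N -> W} :
  open U -> (forall u, U u -> f u = g u) ->
  of_class_C k U f -> of_class_C k U g.
Proof.
move=> oU; elim: k f g => [|k IH] f g fg /= [cf Df].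
  by split=> // u Uu; exact: eq_continuous_at oU fg u Uu (cf u Uu).
split=> [u Uu|i]; first exact: eq_continuous_at oU fg u Uu (cf u Uu).
have [df Cf] := Df i; split=> [u Uu|].
  by apply: near_eq_derivable (df u Uu); exact: near_eq_on_open oU fg u Uu.
by apply: IH Cf => u Uu; apply: eq_partial oU fg u Uu.
Qed.

(** The recursion lowers the class only along partial derivatives, hence the induction. The product
    and quotient rules use this for the factors left undifferentiated. *)
Lemma of_class_CW {W : normedModType R} {k U} {f : 'rV[R]_N -> W} :
  of_class_C k.+1 U f -> of_class_C k U f.
Proof.
elim: k f => [|k IH] f [cf Df]; first exact: (conj cf I).
by split=> // i; have [df Cf] := Df i; split=> //; exact: IH.
Qed.

Lemma smooth_derivable {W : normedModType R} {U} {f : 'rV[R]_N -> W} :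
  smooth U f -> forall i u, U u -> derivable f u (delta_mx 0 i).
Proof. by move=> /(_ 1%N)[_ df] i u Uu; have [+ _] := df i; exact. Qed.

Lemma of_class_C_cst {W : normedModType R} k U (c : W) :
  of_class_C k U (fun _ : 'rV[R]_N => c).
Proof.
elim: k c => [|k IH] c; first by split=> // u _; exact: cst_continuous.
split=> [u _|i]; first exact: cst_continuous.
split=> [u _|]; first exact: derivable_cst.
rewrite (_ : partial i _ = (fun=> 0)); first exact: IH.
by apply/funext => u; exact: derive_cst.
Qed.

Lemma of_class_C_add {W : normedModType R} {k U} {f g : 'rV[R]_N -> W} :
  open U -> of_class_C k U f -> of_class_C k U g ->
  of_class_C k U (fun u => f u + g u).
Proof.
move=> oU; elim: k f g => [|k IH] f g [cf Df] [cg Dg].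
  by split=> // u Uu; apply: continuousD; [exact: cf|exact: cg].
split=> [u Uu|i]; first by apply: continuousD; [exact: cf|exact: cg].
have [df Cf] := Df i; have [dg Cg] := Dg i; split=> [u Uu|].
  by apply: derivableD; [exact: df|exact: dg].
apply: eq_of_class_C oU _ (IH _ _ Cf Cg) => u Uu.
by rewrite /partial -deriveD; [|exact: df|exact: dg].
Qed.

Lemma of_class_C_mul {k U} {f g : 'rV[R]_N -> R} :
  open U -> of_class_C k U f -> of_class_C k U g ->
  of_class_C k U (fun u => f u * g u).
Proof.
move=> oU; elim: k f g => [|k IH] f g Hf Hg.
  have [cf _] := Hf; have [cg _] := Hg.
  by split=> // u Uu; apply: continuousM; [exact: cf|exact: cg].
have [cf Df] := Hf; have [cg Dg] := Hg.
split=> [u Uu|i]; first by apply: continuousM; [exact: cf|exact: cg].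
have [df Cf] := Df i; have [dg Cg] := Dg i; split=> [u Uu|].
  by apply: derivableM; [exact: df|exact: dg].
have := of_class_C_add oU (IH _ _ (of_class_CW Hf) Cg)
  (IH _ _ (of_class_CW Hg) Cf).
apply: eq_of_class_C oU _ => u Uu.
by rewrite /partial deriveM; [|exact: df|exact: dg].
Qed.

(** The derivative is [- (f^-1 * f^-1) * partial i f]: the inverse is of class [k] by induction and
    [partial i f] by assumption. *)
Lemma of_class_C_inv {k U} {f : 'rV[R]_N -> R} :
  open U -> (forall u, U u -> f u != 0) -> of_class_C k U f ->
  of_class_C k U (fun u => (f u)^-1).
Proof.
move=> oU f0; elim: k => [|k IH] Hf.
  by have [cf _] := Hf; split=> // u Uu; apply: continuousV; [exact: f0|exact: cf].
have [cf Df] := Hf.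
split=> [u Uu|i]; first by apply: continuousV; [exact: f0|exact: cf].
have [df Cf] := Df i; split=> [u Uu|].
  by apply: derivableV; [exact: f0|exact: df].
have Cfi := IH (of_class_CW Hf).
have := of_class_C_mul oU (of_class_C_cst (W := R) k U (-1))
  (of_class_C_mul oU (of_class_C_mul oU Cfi Cfi) Cf).
apply: eq_of_class_C oU _ => u Uu.
rewrite /partial deriveV; [|exact: f0|exact: df].
by rewrite -exprVn expr2 mulN1r -scaleNr.
Qed.

Lemma of_class_C_sum {W : normedModType R} {k U} {I : Type} (r : seq I)
    (P : pred I) {F : I -> 'rV[R]_N -> W} :
  open U -> (forall i, P i -> of_class_C k U (F i)) ->
  of_class_C k U (fun u => \sum_(i <- r | P i) F i u).
Proof.
move=> oU CF; elim: r => [|a r IH].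
  by apply: eq_of_class_C oU _ (of_class_C_cst k U 0) => u _; rewrite big_nil.
have [Pa|nPa] := boolP (P a).
  apply: eq_of_class_C oU _ (of_class_C_add oU (CF a Pa) IH) => u _.
  by rewrite big_cons Pa.
by apply: eq_of_class_C oU _ IH => u _; rewrite big_cons (negbTE nPa).
Qed.

Lemma of_class_C_prod {k U} {I : Type} (r : seq I)
    (P : pred I) {F : I -> 'rV[R]_N -> R} :
  open U -> (forall i, P i -> of_class_C k U (F i)) ->
  of_class_C k U (fun u => \prod_(i <- r | P i) F i u).
Proof.
move=> oU CF; elim: r => [|a r IH].
  by apply: eq_of_class_C oU _ (of_class_C_cst (W := R) k U 1) => u _; rewrite big_nil.
have [Pa|nPa] := boolP (P a).
  apply: eq_of_class_C oU _ (of_class_C_mul oU (CF a Pa) IH) => u _.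
  by rewrite big_cons Pa.
by apply: eq_of_class_C oU _ IH => u _; rewrite big_cons (negbTE nPa).
Qed.

Lemma of_class_C_coord {k U} {m n : nat} {M : 'rV[R]_N -> 'M[R]_(m, n)} i j :
  open U -> of_class_C k U M -> of_class_C k U (fun u => M u i j).
Proof.
move=> oU; elim: k M => [|k IH] M [cM DM].
  split=> // u Uu.
  exact: (@continuous_comp _ _ _ M (fun A => A i j) u (cM u Uu)
    (@coord_continuous _ _ _ _ _ _)).
split=> [u Uu|l].
  exact: (@continuous_comp _ _ _ M (fun A => A i j) u (cM u Uu)
    (@coord_continuous _ _ _ _ _ _)).
have [dM CM] := DM l; split=> [u Uu|].
  by have /derivable_mxP := dM u Uu; apply.
by apply: eq_of_class_C oU _ (IH _ CM) => u Uu; rewrite /partial derive_mx ?mxE//;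
  exact: dM.
Qed.

(** The Leibniz formula is polynomial in the entries. The entrywise hypothesis makes the lemma
    directly applicable to minors. *)
Lemma of_class_C_det {k U} {n : nat} {M : 'rV[R]_N -> 'M[R]_n} :
  open U -> (forall i j, of_class_C k U (fun u => M u i j)) ->
  of_class_C k U (fun u => \det (M u)).
Proof.
move=> oU CM; apply: of_class_C_sum => // s _.
apply: of_class_C_mul => //; first exact: of_class_C_cst.
by apply: of_class_C_prod => // i _; exact: CM.
Qed.

(* Cramer's rule reduces the inverse to the determinant and the cofactors. *)
Lemma of_class_C_invmx_coord {k U} {n : nat} {M : 'rV[R]_N -> 'M[R]_n} i j :
  open U -> (forall u, U u -> M u \in unitmx) -> of_class_C k U M ->
  of_class_C k U (fun u => invmx (M u) i j).
Proof.
move=> oU Mu CM.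
have CM' a b : of_class_C k U (fun u => M u a b) by exact: of_class_C_coord.
have det0 u : U u -> \det (M u) != 0.
  by move=> Uu; rewrite -unitfE -unitmxE; exact: Mu.
have Cdet := of_class_C_inv oU det0 (of_class_C_det oU CM').
have Cadj : of_class_C k U (fun u => \adj (M u) i j).
  have Cminor : of_class_C k U (fun u => \det (row' j (col' i (M u)))).
    apply: of_class_C_det => // a b.
    apply: eq_of_class_C oU _ (CM' (lift j a) (lift i b)) => u _.
    by rewrite !mxE.
  apply: eq_of_class_C oU _
    (of_class_C_mul oU (of_class_C_cst (W := R) k U ((-1) ^+ (j + i))) Cminor)
    => u _.
  by rewrite mxE.
apply: eq_of_class_C oU _ (of_class_C_mul oU Cdet Cadj) => u Uu.
by rewrite /invmx Mu// [RHS]mxE.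
Qed.

End Smoothness.

(** * Differentiation of matrix products and transposes *)

Section MatrixDerivative.
Context {R : realType} {V : normedModType R}.

Lemma is_derive_mulmx {m n p : nat} {A : V -> 'M[R]_(m, n)}
    {B : V -> 'M[R]_(n, p)} {u v : V} :
  derivable A u v -> derivable B u v ->
  is_derive u v (fun x => A x *m B x) ('D_v A u *m B u + A u *m 'D_v B u).
Proof.
move=> dA dB.
have entry i j : is_derive u v (fun x => (A x *m B x) i j)
    (('D_v A u *m B u + A u *m 'D_v B u) i j).
  rewrite (_ : (fun x => (A x *m B x) i j) =
    \sum_(k < n) (fun x => A x i k) * (fun x => B x k j)); last first.
    by apply/funext => x; rewrite mxE fct_sumE.
  have dAi k : derivable (fun x => A x i k) u v.
    by move/derivable_mxP: dA; apply.
  have dBi k : derivable (fun x => B x k j) u v.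
    by move/derivable_mxP: dB; apply.
  have dAB k : derivable ((fun x => A x i k) * (fun x => B x k j)) u v.
    exact: derivableM.
  apply: DeriveDef; first exact: derivable_sum.
  rewrite derive_sum// !mxE -big_split/=; apply: eq_bigr => k _.
  by rewrite deriveM// !derive_mx// !mxE addrC; congr (_ + _); rewrite mulrC.
have dAB : derivable (fun x => A x *m B x) u v.
  by apply/derivable_mxP => i j; have [] := entry i j.
apply: DeriveDef => //; rewrite derive_mx//; apply/matrixP => i j.
by rewrite mxE; have [_ ->] := entry i j.
Qed.

Lemma is_derive_trmx {m n : nat} {A : V -> 'M[R]_(m, n)} {u v : V} :
  derivable A u v -> is_derive u v (fun x => (A x)^T) ('D_v A u)^T.
Proof.
move=> dA.
have dAt : derivable (fun x => (A x)^T) u v.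
  apply/derivable_mxP => i j; rewrite (_ : (fun _ => _) = (fun x => A x j i)).
    by move/derivable_mxP: dA; apply.
  by apply/funext => x; rewrite mxE.
apply: DeriveDef => //; rewrite !derive_mx//; apply/matrixP => i j.
by rewrite !mxE; congr ('D_v _ u); apply/funext => x; rewrite mxE.
Qed.

End MatrixDerivative.

(** * The subtracted term of the transformation and its partial derivatives *)

Section Transform.
Context {R : realType} {N m : nat} {U : set 'rV[R]_N}.
Context (xi : 'I_N -> 'rV[R]_N -> 'cV[R]_m)
  (xis : 'I_N -> 'rV[R]_N -> 'rV[R]_m) (Omega : 'rV[R]_N -> 'M[R]_m)
  (openU : open U) (Omega_inv : forall u, U u -> Omega u \in unitmx)
  (smooth_xi : forall i, smooth U (xi i))
  (smooth_xis : forall i, smooth U (xis i))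
  (Omega_pot : potential U xi xis Omega).

Definition dressed (i j : 'I_N) (u : 'rV[R]_N) : R :=
  pairing (xis j u) (invmx (Omega u) *m xi i u).

Lemma smooth_dressed i j : smooth U (dressed i j).
Proof.
move=> k; have [smO _] := Omega_pot.
have Cxi a : of_class_C k U (fun u => xi i u a 0).
  by apply: of_class_C_coord => //; exact: smooth_xi.
have Cxis a : of_class_C k U (fun u => xis j u 0 a).
  by apply: of_class_C_coord => //; exact: smooth_xis.
have Cinv a b : of_class_C k U (fun u => invmx (Omega u) a b).
  by apply: of_class_C_invmx_coord.
have : of_class_C k U (fun u => \sum_(a < m) xis j u 0 a *
    (\sum_(b < m) invmx (Omega u) a b * xi i u b 0)).
  apply: of_class_C_sum => // a _; apply: of_class_C_mul => //.
  by apply: of_class_C_sum => // b _; apply: of_class_C_mul.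
apply: eq_of_class_C openU _ => u _.
rewrite /dressed /pairing mxE; apply: eq_bigr => a _.
by rewrite mxE.
Qed.

Lemma derivable_invmx k u : U u ->
  derivable (fun v => invmx (Omega v)) u (delta_mx 0 k).
Proof.
move=> Uu; have [smO _] := Omega_pot.
apply/derivable_mxP => a b.
have [_ /(_ k)[+ _]] := of_class_C_invmx_coord (k := 1) a b openU Omega_inv (smO 1%N).
exact.
Qed.

(** Differentiate [Omega *m invmx Omega = 1] and solve for the derivative of the inverse. *)
Lemma partial_invmx k u : U u ->
  partial k (fun v => invmx (Omega v)) u =
  - (invmx (Omega u) *m (xi k u *m xis k u) *m invmx (Omega u)).
Proof.
move=> Uu; have [smO potO] := Omega_pot.
have [_] := is_derive_mulmx (smooth_derivable smO k u Uu) (derivable_invmx k u Uu).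
(* The product is known to be the identity on [U] only, so it is replaced by a constant under the
   derivative through locality. *)
rewrite -/(partial k _ u) (eq_partial (g := cst 1%:M) k openU _ u Uu); last first.
  by move=> v Uv; rewrite mulmxV// Omega_inv.
rewrite {1}/partial derive_cst => /esym/eqP; rewrite addrC addr_eq0 => /eqP.
rewrite -/(partial k Omega u) potO//.
move/(congr1 (mulmx (invmx (Omega u)))).
by rewrite mulmxA mulVmx ?Omega_inv// mul1mx mulmxN !mulmxA.
Qed.

(** The value stays an entry of a 1x1 matrix, so that sums over [k] can later be factored through
    matrix products. *)
Lemma partial_dressed i j k u : U u ->
  partial k (dressed i j) u =
  (partial k (xis j) u *m invmx (Omega u) *m xi i u
   - xis j u *m invmx (Omega u) *m (xi k u *m xis k u) *m invmx (Omega u)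
     *m xi i u
   + xis j u *m invmx (Omega u) *m partial k (xi i) u) 0 0.
Proof.
move=> Uu.
have dxi := smooth_derivable (smooth_xi i) k u Uu.
have dxis := smooth_derivable (smooth_xis j) k u Uu.
have [d1 e1] := is_derive_mulmx (derivable_invmx k u Uu) dxi.
have [d2 e2] := is_derive_mulmx dxis d1.
have -> : partial k (dressed i j) u = ('D_(delta_mx 0 k)
    (fun v => xis j v *m (invmx (Omega v) *m xi i v)) u) 0 0.
  by rewrite derive_mx// mxE.
rewrite e2 e1 -/(partial k (xis j) u) -/(partial k (xi i) u).
rewrite -/(partial k (fun v => invmx (Omega v)) u) partial_invmx//.
by rewrite mulmxDr mulNmx mulmxN !mulmxA addrA.
Qed.

End Transform.

(** * The Darboux-Egoroff equations for the transformed coefficients *)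

Theorem mainTheorem4 (R : realType) (N m : nat) (U : set 'rV[R]_N)
    (beta : 'I_N -> 'I_N -> 'rV[R]_N -> R)
    (xi : 'I_N -> 'rV[R]_N -> 'cV[R]_m)
    (xis : 'I_N -> 'rV[R]_N -> 'rV[R]_m)
    (Omega : 'rV[R]_N -> 'M[R]_m) (L : 'M[R]_m)
    (openU : open U)
    (DE_beta : darboux_egoroff U beta)
    (xi_sol : linear_system U beta xi)
    (xis_sol : adjoint_linear_system U beta xis)
    (Omega_pot : potential U xi xis Omega)
    (Omega_inv : forall u, U u -> Omega u \in unitmx)
    (xis_L : forall i u, U u -> xis i u = (xi i u)^T *m L)
    (xi_L : forall i u, U u ->
      (xi i u)^T *m L =
      (partial i (xi i) u + \sum_(k < N | k != i) beta k i u *: xi k u)^T)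
    (L_Omega : forall u, U u -> L^T *m Omega u - (Omega u)^T *m L = 0)
    (Omega_sym : forall u, U u ->
      Omega u + (Omega u)^T = \sum_(k < N) xi k u *m (xi k u)^T) :
  darboux_egoroff U (transformed_beta beta xi xis Omega).
Proof.
have [smooth_beta rot symm flat] := DE_beta.
have [smooth_xi d_xi] := xi_sol; have [smooth_xis d_xis] := xis_sol.
pose c := dressed xi xis Omega.
have d_c i j k u (Uu : U u) :=
  partial_dressed xi xis Omega openU Omega_inv smooth_xi smooth_xis Omega_pot i j k u Uu.
have smooth_c i j : smooth U (c i j) by exact: smooth_dressed.
have d_beta_hat i j k u : i != j -> U u ->
    partial k (transformed_beta beta xi xis Omega i j) u =
    partial k (beta i j) u - partial k (c i j) u.
  move=> ij Uu; rewrite /partial -deriveB//.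
    exact: smooth_derivable (smooth_beta i j ij) k u Uu.
  exact: smooth_derivable (smooth_c i j) k u Uu.
have LOmega u : U u -> L^T *m Omega u = (Omega u)^T *m L.
  by move=> Uu; apply/eqP; rewrite -subr_eq0 L_Omega.
split.
- move=> i j ij k.
  have Cc := of_class_C_mul openU (of_class_C_cst (W := R) k U (-1)) (smooth_c i j k).
  apply: eq_of_class_C openU _ (of_class_C_add openU (smooth_beta i j ij k) Cc).
  by move=> u _; rewrite mulN1r.
(* The linear systems reduce the claim to the expansion of
   [(beta i k - c i k) * (beta k j - c k j)]. *)
- move=> i j k ij jk ik u Uu; rewrite d_beta_hat// rot//.
  rewrite d_c// d_xi 1?eq_sym// d_xis 1?eq_sym//.
  rewrite /transformed_beta /pairing -!scalemxAr -!scalemxAl !mulmxA.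
  (* Reassociation splits the quadratic term at [xi k u *m xis k u] into the 1x1 matrices [p] and
     [q], whose entries are [c k j] and [c i k]. *)
  rewrite -(mulmxA _ (xis k u)) -(mulmxA _ (xis k u *m _)).
  set p := xis j u *m _ *m xi k u; set q := xis k u *m _ *m _.
  by move: p q => p q; rewrite !mxE big_ord1; ring.
- move=> i j ij u Uu; rewrite /transformed_beta symm//; congr (_ - _).
  rewrite /pairing !xis_L//.
  have LW : (L *m invmx (Omega u))^T = L *m invmx (Omega u).
    have Ou := Omega_inv u Uu; have OTu : (Omega u)^T \in unitmx.
      by rewrite unitmx_tr.
    (* After left multiplication by the invertible [(Omega u)^T] both sides equal [L^T]. *)
    apply: (can_inj (mulKmx OTu)).
    by rewrite [RHS]mulmxA -LOmega// mulmxK// trmx_mul trmx_inv mulKVmx.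
  have tr11 (p : 'M[R]_1) : p 0 0 = p^T 0 0 by rewrite mxE.
  rewrite -!mulmxA !(mulmxA L) [LHS]tr11 trmx_mul (trmx_mul _ (xi i u)).
  by rewrite LW trmxK mulmxA.
- move=> i j ij u Uu.
  under eq_bigr do rewrite d_beta_hat//.
  rewrite sumrB flat// sub0r; apply/eqP; rewrite oppr_eq0; apply/eqP.
  have Ou := Omega_inv u Uu.
  (* Transposing [xi_L] gives the diagonal derivative plus terms [beta k a *: xi k], which symmetry
     of [beta] identifies with the derivatives [partial k (xi a)]. *)
  have sum_xi a : \sum_(k < N) partial k (xi a) u = L^T *m xi a u.
    have := congr1 trmx (xi_L a u Uu); rewrite trmxK trmx_mul trmxK => ->.
    rewrite (bigD1 a)//=; congr (_ + _); apply: eq_bigr => k ka.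
    by rewrite d_xi// symm// eq_sym.
  have sum_xis a : \sum_(k < N) partial k (xis a) u = xis a u *m L.
    (* As [L] is constant, differentiating [xis_L] transfers the previous sum from [xi] to [xis]. *)
    have d_xis_L k : partial k (xis a) u = (partial k (xi a) u)^T *m L.
      rewrite (eq_partial k openU (xis_L a) u Uu) /partial.
      have [dT eT] := is_derive_trmx (smooth_derivable (smooth_xi a) k u Uu).
      have [_ ->] := is_derive_mulmx dT (derivable_cst L u (delta_mx 0 k)).
      by rewrite eT derive_cst mulmx0 addr0.
    under eq_bigr do rewrite d_xis_L.
    have tr_sum : \sum_(k < N) (partial k (xi a) u)^T = (L^T *m xi a u)^T.
      by rewrite -sum_xi raddf_sum.
    by rewrite -mulmx_suml tr_sum trmx_mul trmxK xis_L.
  have sum_Omega : \sum_(k < N) xi k u *m xis k u = (Omega u + (Omega u)^T) *m L.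
    rewrite Omega_sym// mulmx_suml; apply: eq_bigr => k _.
    by rewrite xis_L// mulmxA.
  pose W := invmx (Omega u).
  have sum1 : \sum_(k < N) partial k (xis j) u *m W *m xi i u =
      xis j u *m L *m W *m xi i u.
    by rewrite -!mulmx_suml sum_xis.
  have sum2 : \sum_(k < N) xis j u *m W *m (xi k u *m xis k u) *m W *m xi i u =
      xis j u *m W *m ((Omega u + (Omega u)^T) *m L) *m W *m xi i u.
    by rewrite -!mulmx_suml -mulmx_sumr sum_Omega.
  have sum3 : \sum_(k < N) xis j u *m W *m partial k (xi i) u =
      xis j u *m W *m (L^T *m xi i u).
    by rewrite -mulmx_sumr sum_xi.
  under eq_bigr do rewrite d_c//.
  rewrite -summxE !big_split/= sumrN sum1 sum2 sum3.
  (* In the summand with [(Omega u)^T *m L], substituting [L^T *m Omega u] lets [Omega u] cancel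
     against the right-hand [W]; in the other summand it cancels against the left-hand one. *)
  have -> : xis j u *m W *m ((Omega u + (Omega u)^T) *m L) *m W =
    xis j u *m L *m W + xis j u *m W *m L^T.
    rewrite mulmxDl mulmxDr mulmxDl -(LOmega u Uu) !mulmxA.
    by rewrite mulmxKV// mulmxK.
  by rewrite mulmxDl !mulmxA opprD addrA subrr sub0r addNr mxE.
Qed.
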